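(* Let $H=(V,\mathcal E,\psi_H)$ be a finite hypergraph and let $\mathbb K$ be a field. For each edge $e\in\mathcal E$ choose a vertex $v_e\in e$ and set $$U_e:=\langle\varepsilon_v-\varepsilon_{v_e}:v\in e\setminus\{v_e\}\rangle_{\mathbb K}\subseteq\mathbb K^V,$$ where $(\varepsilon_v)_{v\in V}$ is the standard basis of $\mathbb K^V$. Then for every $A\subseteq\mathcal E$, $$\dim_{\mathbb K}\Bigl(\sum_{e\in A}U_e\Bigr)=f_H(A).$$ Consequently, $f_H$ is representable over every field $\mathbb K$; in particular, it is $\mathbb F_q$-representable for every prime power $q$.
   Context: A finite hypergraph is a triple $H=(V,\mathcal E,\psi_H)$ with finite sets $V$ (vertices), $\mathcal E$ (edges), and a map $\psi_H:\mathcal E\to2^V\setminus\{\emptyset\}$; distinct edges may have the same vertex set, and an edge $e$ is identified with its vertex set $\psi_H(e)$ when writing $v\in e$. Two vertices are in the same connected component if they are joined by a walk $u_0,e_1,u_1,\ldots,e_\ell,u_\ell$ with $u_{i-1},u_i\in e_i$. For $A\subseteq\mathcal E$, $\kappa(A)$ is the number of connected components of the spanning subhypergraph $H_A=(V,A,\psi_H|_A)$, isolated vertices included. The hypergraphic function is $f_H:2^{\mathcal E}\to\mathbb Z_{\ge0}$, $f_H(A):=|V|-\kappa(A)$. A set function $\rho:2^E\to\mathbb Z_{\geq 0}$ (rank function of an integer polymatroid) is $\mathbb K$-representable if there are a finite-dimensional $\mathbb K$-vector space $W$ and subspaces $U_x\subseteq W$ ($x\in E$) with $\rho(A)=\dim_{\mathbb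 K}\sum_{x\in A}U_x$ for all $A\subseteq E$. *)

(* Defs.v *)
From HB Require Import structures.
From mathcomp Require Import all_boot all_order all_fingroup all_algebra all_field.
Set Implicit Arguments.
Unset Strict Implicit.
Unset Printing Implicit Defensive.
Import GRing.Theory.
Local Open Scope ring_scope.

Record hypergraph (V E : finType) := Hypergraph {
  vset :> E -> {set V};
  vset_neq0 : forall e, vset e != set0
}.

Section Hypergraph.
Variables V E : finType.
Implicit Type H : hypergraph V E.

Definition hadj H : rel V := fun u v => [exists e, (u \in H e) && (v \in H e)].

(* [connect (hadj H) u v] holds iff some walk u = u_0, e_1, u_1, ..., u_l = v
   (possibly with l = 0) has u_{i-1} and u_i in e_i for all i. *)
Definition ncomponents H : nat := n_comp (hadj H) V.

End Hypergraph.

Section HypergraphicFunction.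
Variables (V E : finType) (H : hypergraph V E).
Implicit Type A : {set E}.

Definition spanning_sub A : hypergraph V {e : E | e \in A} :=
  @Hypergraph V {e : E | e \in A} (fun e => H (val e))
    (fun e => vset_neq0 H (val e)).

Definition kappa A : nat := ncomponents (spanning_sub A).

(* The subtraction on nat does not truncate, by [kappa_le]. *)
Definition hypergraphic A : nat := (#|V| - kappa A)%N.

Lemma hadj_sym : connect_sym (hadj H).
Proof.
apply: sym_connect_sym => u v.
by apply: eq_existsb => e; rewrite andbC.
Qed.

Lemma kappa_le A : (kappa A <= #|V|)%N.
Proof. exact: max_card. Qed.

End HypergraphicFunction.

Definition representable (K : fieldType) (E : finType)
    (rho : {set E} -> nat) : Prop :=
  exists (W : vectType K) (U : E -> {vspace W}),
    forall A : {set E}, rho A = \dim (\sum_(x in A) U x)%VS.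

Section EdgeSpace.
Variables (K : fieldType) (V E : finType) (H : hypergraph V E).

Definition std_basis (v : V) : {ffun V -> K^o} := [ffun u => (u == v)%:R].

Definition edge_space (r : E -> V) (e : E) : {vspace {ffun V -> K^o}} :=
  <<[seq std_basis v - std_basis (r e) | v <- enum (H e :\ r e)]>>%VS.

End EdgeSpace.

(* The field with p ^ k elements. *)
Definition galois_field (p k : nat) (p_pr : prime p) (k_gt0 : (0 < k)%N) :
  finFieldType := s2val (pPrimePowerField p_pr k_gt0).

Lemma card_galois_field (p k : nat) (p_pr : prime p) (k_gt0 : (0 < k)%N) :
  #|galois_field p_pr k_gt0| = (p ^ k)%N.
Proof. exact: (s2valP' (pPrimePowerField p_pr k_gt0)). Qed.

(* Main.v *)
Require Import Defs.
From HB Require Import structures.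
From mathcomp Require Import all_boot all_order all_fingroup all_algebra all_field.
Set Implicit Arguments.
Unset Strict Implicit.
Unset Printing Implicit Defensive.
Import GRing.Theory.
Local Open Scope ring_scope.

(** Modulo the sum of the spaces [U_e], [e \in A], two basis vectors coincide as
    soon as their vertices are joined by a walk in [H_A].  Hence the sum is
    spanned by the differences [std_basis v - std_basis (root v)], where [root]
    selects one vertex in each component, and its codimension is the number of
    components, over any field. *)

Section ConnectedDifferences.
Variables (K : fieldType) (V : finType) (e : rel V).
Hypothesis e_sym : connect_sym e.
Local Notation std := (@std_basis K V).

Definition root_diff (v : V) : {ffun V -> K^o} := std v - std (fingraph.root e v).

(** Only non-roots are used as generators, so that their number is already [#|V|] minus the number
    of components. *)
Definition root_diffs : {vspace {ffun V -> K^o}} :=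
  <<[seq root_diff v | v <- enum [predC roots e]]>>%VS.

Lemma mem_root_diffs v : root_diff v \in root_diffs.
Proof.
have [/eqP rv|nrv] := boolP (fingraph.root e v == v).
  by rewrite /root_diff rv subrr mem0v.
by apply/memv_span/map_f; rewrite mem_enum.
Qed.

(** Connected vertices have the same root, which cancels when their root differences are
    subtracted. *)
Lemma mem_root_diffs_connect u v : connect e u v -> std u - std v \in root_diffs.
Proof.
rewrite -(root_connect e_sym) => /eqP ruv.
have -> : std u - std v = root_diff u - root_diff v.
  by rewrite /root_diff ruv opprB addrA subrK.
by rewrite memvB ?mem_root_diffs.
Qed.

Lemma ffun_std_basis (f : {ffun V -> K^o}) : f = \sum_v f v *: std v.
Proof.
apply/ffunP=> u; rewrite sum_ffunE (bigD1 u) //= !ffunE eqxx.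
rewrite big1 ?addr0 => [|v /negbTE vu]; first by rewrite /GRing.scale /= mulr1.
by rewrite !ffunE eq_sym vu scaler0.
Qed.

(* Both bounds come from generating families: the differences at the non-roots
   span [root_diffs], and adding the basis vectors at the roots gives all of
   [K^V]; no linear independence has to be checked. *)
Lemma dim_root_diffs : \dim root_diffs = (#|V| - n_comp e V)%N.
Proof.
have nE : n_comp e V = #|roots e|.
  by apply: eq_card => v; rewrite !inE andbT.
set R := <<[seq std v | v <- enum (roots e)]>>%VS.
have dimR : (\dim R <= #|roots e|)%N.
  by apply: leq_trans (dim_span _) _; rewrite size_map -cardE.
have full : (fullv <= root_diffs + R)%VS.
  apply/subvP=> f _; rewrite (ffun_std_basis f) memv_suml // => v _.
  rewrite memvZ // -[std v](subrK (std (fingraph.root e v))) memv_add ?mem_root_diffs //.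
  by apply/memv_span/map_f; rewrite mem_enum; apply: roots_root.
apply/eqP; rewrite eqn_leq nE; apply/andP; split.
  apply: leq_trans (dim_span _) _.
  by rewrite size_map -cardE -(cardC (roots e)) addKn.
(* By [full] and subadditivity of dimension, [#|V|] is at most the dimension of [root_diffs] plus
   that of [R]. *)
rewrite leq_subLR addnC; apply: leq_trans (leq_add (leqnn _) dimR).
apply: leq_trans (dimv_add_leqif _ _).
by apply: leq_trans (dimvS full); rewrite dimvf /dim /= muln1.
Qed.

End ConnectedDifferences.

Section EdgeSpaces.
Variables (K : fieldType) (V E : finType) (H : hypergraph V E) (r : E -> V).
Local Notation std := (@std_basis K V).

Lemma mem_edge_space e u v :
  u \in H e -> v \in H e -> std u - std v \in edge_space K H r e.
Proof.
have base w : w \in H e -> std w - std (r e) \in edge_space K H r e.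
  move=> we; have [->|wr] := eqVneq w (r e); first by rewrite subrr mem0v.
  by apply/memv_span/map_f; rewrite mem_enum !inE wr.
move=> ue ve; rewrite -[std u](subrK (std (r e))) -addrA -[X in _ + X]opprB.
by rewrite memvB ?base.
Qed.

(** The difference telescopes along a walk, and each step of the walk contributes an element of a
    single edge space. *)
Lemma mem_sum_edge_space (A : {set E}) u v :
  connect (hadj (spanning_sub H A)) u v ->
  std u - std v \in (\sum_(e in A) edge_space K H r e)%VS.
Proof.
case/connectP=> p; elim: p u => [|w p IHp] u /=.
  by move=> _ ->; rewrite subrr mem0v.
case/andP=> /existsP[[e eA] /= /andP[ue we]] pathp lastp.
rewrite -[std u](subrK (std w)) -addrA memvD ?IHp //.
exact: (subvP (sumv_sup e eA (subvv _))) (mem_edge_space ue we).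
Qed.

Lemma sum_edge_spaceE (A : {set E}) : (forall e, r e \in H e) ->
  (\sum_(e in A) edge_space K H r e)%VS
    = root_diffs K (hadj (spanning_sub H A)).
Proof.
move=> rH; apply/eqP; rewrite eqEsubv; apply/andP; split.
  apply/subv_sumP=> e eA; apply/span_subvP=> _ /mapP[v + ->].
  rewrite mem_enum => /setD1P[_ ve].
  (* A generator of [edge_space] involves two vertices of the same edge [e], hence of one component;
     this uses that [r e] lies in [e]. *)
  apply: (mem_root_diffs_connect K (hadj_sym (spanning_sub H A))).
  by apply/connect1/existsP; exists (exist _ e eA); rewrite /= ve rH.
by apply/span_subvP=> _ /mapP[v _ ->]; apply/mem_sum_edge_space/connect_root.
Qed.

Lemma dim_sum_edge_space (A : {set E}) : (forall e, r e \in H e) ->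
  \dim (\sum_(e in A) edge_space K H r e)%VS = hypergraphic H A.
Proof.
by move=> rH; rewrite sum_edge_spaceE // dim_root_diffs //; apply: hadj_sym.
Qed.

End EdgeSpaces.

Lemma hypergraphic_representable (K : fieldType) (V E : finType)
  (H : hypergraph V E) : representable K (hypergraphic H).
Proof.
have rP e : exists v, v \in H e by apply/set0Pn/vset_neq0.
(* Edges are nonempty, so a vertex can be chosen in each. *)
exists {ffun V -> K^o}, (edge_space K H (fun e => xchoose (rP e))) => A.
by rewrite dim_sum_edge_space // => e; apply: xchooseP.
Qed.

Theorem theorem4p2 (V E : finType) (H : hypergraph V E) :
  [/\ forall (K : fieldType) (r : E -> V), (forall e : E, r e \in H e) ->
        forall A : {set E},
          \dim (\sum_(e in A) edge_space K H r e)%VS = hypergraphic H A,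
      forall K : fieldType, representable K (hypergraphic H)
    & forall (p k : nat) (p_pr : prime p) (k_gt0 : (0 < k)%N),
        representable (galois_field p_pr k_gt0) (hypergraphic H)].
Proof.
split=> [K r rH A|K|p k p_pr k_gt0]; first exact: dim_sum_edge_space.
  exact: hypergraphic_representable.
exact: hypergraphic_representable.
Qed.
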